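(* For any matroid $\mathcal{M}$ on a finite set $X$, every real root of $\mathrm{Rel}(\mathcal{M};q)$ lies in $[-1,0)\cup\{1\}$; in particular, all real roots lie in the closed unit disk.
   Context: A matroid on a nonempty finite set $X$ is a nonempty collection $\mathcal{M}$ of subsets of $X$ (faces/independent sets) closed under taking subsets and satisfying the exchange axiom: if $\sigma,\alpha\in\mathcal{M}$ with $|\sigma|<|\alpha|$, there is $z\in\alpha\setminus\sigma$ with $\sigma\cup\{z\}\in\mathcal{M}$. The reliability polynomial is $\mathrm{Rel}(\mathcal{M};q)=\sum_{\sigma\in\mathcal{M}} q^{|\sigma|}(1-q)^{|X\setminus\sigma|}$. *)

(* Defs.v *)
From HB Require Import structures.
From mathcomp Require Import all_boot all_order all_algebra.
From mathcomp Require Import reals.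

Set Implicit Arguments.
Unset Strict Implicit.
Unset Printing Implicit Defensive.

Import Order.TTheory GRing.Theory Num.Theory.
Local Open Scope ring_scope.

(* The ground set is the whole finite type X. Loops (x with [set x] \notin M)
   are allowed. *)
Record is_matroid (X : finType) (M : {set {set X}}) : Prop := IsMatroid {
  matroid_ground : (0 < #|X|)%N;
  matroid_nonempty : M != set0;
  matroid_sub : forall s t : {set X}, s \in M -> t \subset s -> t \in M;
  matroid_exchange : forall s a : {set X}, s \in M -> a \in M ->
    (#|s| < #|a|)%N -> exists2 z, z \in a :\: s & z |: s \in M
}.

Definition Rel (R : realType) (X : finType) (M : {set {set X}}) : {poly R} :=
  \sum_(s in M) 'X ^+ #|s| * (1 - 'X) ^+ #|~: s|.

(* Main.v *)
(** For [q < -1] it suffices to treat coloopless matroids, since coloops do not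
    affect the polynomial.  If [D] is a maximal proper coloopless subset of the
    ground set [E], then [S = E \ D] is a series class of size [k]: every proper
    subset of [S] can be added freely to an independent subset of [D].  Grouping
    the faces by their trace on [S] gives
      Rel(M) = (1 - q^k) Rel(M \ S) + q^k Rel(M / S),
    both minors are coloopless, of ranks [r - k + 1] and [r - k], and for
    [q < -1] both terms have sign [(-1)^r].  For [q > 1] the same identity with
    [k = 1] (deletion-contraction) shows that the sign of the polynomial is
    [(-1)^(|E| - r)]. *)
Require Import Defs.
From HB Require Import structures.
From mathcomp Require Import all_boot all_order all_algebra.
From mathcomp Require Import reals ring lra zify.

Set Implicit Arguments.
Unset Strict Implicit.
Unset Printing Implicit Defensive.

Import Order.TTheory GRing.Theory Num.Theory.
Local Open Scope ring_scope.

(** * Weighted face sums over a disjoint union *)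

Lemma sum_subsetU (V : nmodType) (X : finType) (D S : {set X})
    (F : {set X} -> V) :
  [disjoint D & S] ->
  \sum_(s : {set X} | s \subset D :|: S) F s =
  \sum_(a : {set X} | a \subset D) \sum_(b : {set X} | b \subset S) F (a :|: b).
Proof.
move=> dDS; rewrite (partition_big (fun s => s :&: D) (fun a => a \subset D)) /=;
  last by move=> s _; exact: subsetIr.
apply: eq_bigr => a aD.
have aS0 : a :&: S = set0.
  by apply/eqP; rewrite setI_eq0; exact: disjointWl dDS.
have cap (b : {set X}) : b \subset S ->
    (a :|: b) :&: S = b /\ (a :|: b) :&: D = a.
  move=> bS; have bD0 : b :&: D = set0.
    by apply/eqP; rewrite setI_eq0 disjoint_sym; exact: disjointWr dDS.
  by rewrite !setIUl aS0 bD0 set0U setU0 (setIidPl bS) (setIidPl aD).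
(* With the trace [a] on [D] fixed, [s] is determined by its trace on [S]. *)
rewrite (reindex_onto (fun b => a :|: b) (fun s => s :&: S)) /=; last first.
  by move=> s /andP[sE /eqP <-]; rewrite -setIUr; apply/setIidPl.
apply: eq_bigl => b; apply/andP/idP => [[_ /eqP <-]|bS]; first exact: subsetIr.
by have [-> ->] := cap b bS; rewrite !eqxx setUSS.
Qed.

Section Weights.
Variables (R : comNzRingType) (X : finType) (q : R).
Implicit Types (I : {set {set X}}) (D S E a b s t : {set X}).

Definition face_weight E s : R := q ^+ #|s| * (1 - q) ^+ #|E :\: s|.

(** The value at [q] of the reliability polynomial of the restriction to [E]. The family [I] stays
    on all of [X], so a deletion only shrinks [E]. *)
Definition rel_on I E : R := \sum_(s in I | s \subset E) face_weight E s.

Lemma face_weightU D S a b : [disjoint D & S] -> a \subset D -> b \subset S ->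
  face_weight (D :|: S) (a :|: b) = face_weight D a * face_weight S b.
Proof.
move=> dDS aD bS; rewrite /face_weight.
have dab : [disjoint a & b] by apply: disjointWl aD (disjointWr bS dDS).
have -> : (D :|: S) :\: (a :|: b) = (D :\: a) :|: (S :\: b).
  apply/setP=> x; rewrite !inE.
  have := subsetP aD x; have := subsetP bS x.
  have := disjointFr dDS (x := x).
  by case: (x \in a); case: (x \in b); case: (x \in D); case: (x \in S);
    do ?[move=> H; have := H isT; clear H]; intuition.
have dd : [disjoint D :\: a & S :\: b].
  by apply: disjointWl (subsetDl _ _) (disjointWr (subsetDl _ _) dDS).
rewrite !cardsU.
move: dab dd; rewrite -!setI_eq0 => /eqP -> /eqP ->.
by rewrite cards0 !subn0 !exprD; ring.
Qed.

(** This is the expansion of [(q + (1 - q)) ^+ #|S|], obtained by peeling off one point at a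
    time. *)
Lemma sum_face_weight S : \sum_(b : {set X} | b \subset S) face_weight S b = 1.
Proof.
elim: {S}#|S| {-2}S (erefl #|S|) => [|n IH] S cS.
  move/eqP: cS; rewrite cards_eq0 => /eqP ->.
  under eq_bigl do rewrite subset0.
  by rewrite big_pred1_eq /face_weight setDv cards0 !expr0 mulr1.
have [e eS] : exists e, e \in S by apply/set0Pn; rewrite -card_gt0 cS.
have dS : [disjoint S :\ e & [set e]] by rewrite disjoint_sym disjoints1 !inE eqxx.
rewrite -(setD1K eS) setUC sum_subsetU //.
have c' : #|S :\ e| = n by move: cS; rewrite (cardsD1 e) eS add1n => -[].
rewrite -[RHS](IH _ c'); apply: eq_bigr => a aS.
transitivity (\sum_(b : {set X} | b \subset [set e])
    face_weight (S :\ e) a * face_weight [set e] b).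
  by apply: eq_bigr => b bS; exact: face_weightU.
rewrite -big_distrr /=.
have ne : [set e] != set0 by rewrite -card_gt0 cards1.
rewrite (bigD1 [set e]) //= (bigD1 set0) /=; last by rewrite sub0set eq_sym.
rewrite big1 => [|b]; last first.
  by rewrite subset1 => /andP[/andP[/orP[]/eqP->]]; rewrite eqxx.
by rewrite /face_weight setDv setD0 cards0 cards1; ring.
Qed.

(** The ground type is kept, so the elements of [S] become loops. If [I] is a matroid and [S] is
    dependent, this family is empty. *)
Definition contraction I S : {set {set X}} :=
  [set s : {set X} | [disjoint s & S] && (s :|: S \in I)].

(** Fix a face [a] inside [D]. All proper subsets of [S] extend it and together carry weight
    [1 - q ^+ #|S|]; the full set [S] extends it exactly when [a] is a face of the contraction. *)
Lemma rel_onU I D S :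
  (forall s t, s \in I -> t \subset s -> t \in I) ->
  [disjoint D & S] ->
  (forall a b, a \in I -> a \subset D -> b \proper S -> a :|: b \in I) ->
  rel_on I (D :|: S) =
    (1 - q ^+ #|S|) * rel_on I D + q ^+ #|S| * rel_on (contraction I S) D.
Proof.
move=> Isub dDS freeS; rewrite /rel_on.
rewrite (eq_bigl (fun s => (s \subset D :|: S) && (s \in I)));
  last by move=> s; rewrite andbC.
rewrite big_mkcondr sum_subsetU //= [in RHS]big_mkcond /=.
rewrite (big_mkcond (fun s => (s \in contraction I S) && _)) /=.
rewrite (big_mkcond (fun a => a \subset D)) /=.
rewrite !big_distrr -big_split; apply: eq_bigr => a _ /=.
case: ifP => aD; last by rewrite !andbF !mulr0 addr0.
rewrite !andbT inE (disjointWl aD dDS) /=.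
case: ifP => aI; last first.
  rewrite big1 => [|b _]; last first.
    by rewrite ifF //; apply/negbTE; apply: contraFN aI => /Isub; apply;
      exact: subsetUl.
  by rewrite ifF ?mulr0 ?addr0 //; apply/negbTE; apply: contraFN aI => /Isub;
    apply; exact: subsetUl.
have tot : face_weight D a =
    \sum_(b : {set X} | b \subset S) face_weight D a * face_weight S b.
  by rewrite -big_distrr /= sum_face_weight mulr1.
rewrite (bigD1 S) //= in tot.
have wS : face_weight S S = q ^+ #|S|.
  by rewrite /face_weight setDv cards0 expr0 mulr1.
have proper_part :
    \sum_(b : {set X} | (b \subset S) && (b != S))
      (if a :|: b \in I then face_weight (D :|: S) (a :|: b) else 0) =
    face_weight D a - face_weight D a * q ^+ #|S|.
  (* The weights over all subsets of [S] sum to 1; removing the term of [S] leaves the proper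
     subsets. *)
  rewrite {1}tot wS [RHS]addrC addKr.
  apply: eq_bigr => b /andP[bS bnS].
  by rewrite freeS ?face_weightU // properEneq bnS.
rewrite (bigD1 S) //= proper_part; case: ifP => aSI; last by ring.
by rewrite face_weightU // wS; ring.
Qed.

(** Here the contraction has the same faces inside [D] as [I], so the two terms of [rel_onU]
    merge. *)
Lemma rel_onU_free I D S :
  (forall s t, s \in I -> t \subset s -> t \in I) ->
  [disjoint D & S] ->
  (forall a, a \in I -> a \subset D -> a :|: S \in I) ->
  rel_on I (D :|: S) = rel_on I D.
Proof.
move=> Isub dDS freeS; rewrite rel_onU //; last first.
  move=> a b aI aD /proper_sub bS; apply: Isub (freeS a aI aD) _.
  exact: setUS.
have -> : rel_on (contraction I S) D = rel_on I D; last by ring.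
apply: eq_bigl => a; rewrite inE.
case: (boolP (a \subset D)) => aD; rewrite ?andbF // !andbT (disjointWl aD dDS) /=.
apply/idP/idP => [/Isub|/freeS]; first by apply; exact: subsetUl.
exact.
Qed.

End Weights.

(** * Bases and coloops *)

Section Matroid.
Variable X : finType.
Implicit Types (I : {set {set X}}) (B D S E T a b s t : {set X}).

Definition basis I E B :=
  [/\ B \in I, B \subset E &
      forall s, s \in I -> s \subset E -> (#|s| <= #|B|)%N].

Definition coloop I E e := [forall s in I, (s \subset E) ==> (e |: s \in I)].

Definition coloopless I E := [forall e in E, ~~ coloop I E e].

Lemma coloopP I E e :
  reflect (forall s, s \in I -> s \subset E -> e |: s \in I) (coloop I E e).
Proof.
apply: (iffP forall_inP) => [H s sI sE|H s sI]; first exact: (implyP (H s sI)).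
by apply/implyP; exact: H.
Qed.

Lemma coloopPn I E e :
  reflect (exists s, [/\ s \in I, s \subset E & e |: s \notin I])
          (~~ coloop I E e).
Proof.
apply: (iffP forall_inPn) => [[s sI]|[s [sI sE esI]]].
  by rewrite negb_imply => /andP[sE esI]; exists s.
by exists s => //; rewrite negb_imply sE.
Qed.

Variables (I : {set {set X}}) (hI : is_matroid I).

Lemma matroid_set0 : set0 \in I.
Proof.
have /set0Pn[s sI] := matroid_nonempty hI.
exact: (matroid_sub hI sI (sub0set s)).
Qed.

Lemma basis_exists E : exists B, basis I E B.
Proof.
have P0 : (set0 \in I) && (set0 \subset E) by rewrite matroid_set0 sub0set.
case: (@arg_maxnP _ set0 (fun s => (s \in I) && (s \subset E))
         (fun s => #|s|) P0) => B /andP[BI BE] Bmax.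
by exists B; split=> // s sI sE; apply: Bmax; rewrite sI.
Qed.

Lemma basis_card E B B' : basis I E B -> basis I E B' -> #|B| = #|B'|.
Proof.
move=> [BI BE Bm] [BI' BE' Bm']; apply/eqP.
by rewrite eqn_leq Bm' // Bm.
Qed.

Lemma basis_maximal E B :
  B \in I -> B \subset E -> (forall z, z \in E :\: B -> z |: B \notin I) ->
  basis I E B.
Proof.
move=> BI BE Bm; split=> // s sI sE; rewrite leqNgt; apply/negP => lt.
have [z /setDP[zs zB] zI] := matroid_exchange hI BI sI lt.
by have := Bm z; rewrite inE zB (subsetP sE) // zI => /(_ isT).
Qed.

Lemma basis_maxP E B z : basis I E B -> z \in E -> z \notin B -> z |: B \notin I.
Proof.
move=> [BI BE Bm] zE zB; apply/negP => /Bm.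
by rewrite subUset sub1set zE BE cardsU1 zB add1n ltnn => /(_ isT).
Qed.

Lemma augment s a : s \in I -> a \in I -> (#|s| <= #|a|)%N ->
  exists t, [/\ t \in I, s \subset t, t \subset s :|: a & #|t| = #|a|].
Proof.
move=> sI aI; move En: (#|a| - #|s|)%N => n.
elim: n s sI En => [|n IH] s sI En le.
  by exists s; split=> //; [exact: subsetUl | lia].
have [|z /setDP[za zs] zI] := matroid_exchange hI sI aI; first by lia.
have cz : #|z |: s| = #|s|.+1 by rewrite cardsU1 zs.
have [||t [tI st ta ct]] := IH _ zI; rewrite ?cz; try lia.
exists t; split=> //; first by apply: subset_trans st; exact: subsetUr.
apply: subset_trans ta _; rewrite subUset subsetUr subUset sub1set inE za orbT.
by rewrite subsetUl.
Qed.

(** Extend an independent [s] for which [e |: s] is dependent to a basis; that basis cannot contain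
    [e]. *)
Lemma basis_avoiding E e : ~~ coloop I E e -> exists2 B, basis I E B & e \notin B.
Proof.
move=> /coloopPn[s [sI sE esI]].
have [A bA] := basis_exists E; have [AI AE Am] := bA.
have [t [tI st ta ct]] := augment sI AI (Am _ sI sE).
exists t.
  split=> //; last by move=> u uI uE; rewrite ct Am.
  by apply: subset_trans ta _; rewrite subUset sE.
apply: contra esI => et; apply: matroid_sub hI _ _ tI _.
by rewrite subUset sub1set et.
Qed.

Lemma add_coloops E s T : s \in I -> s \subset E -> T \subset E ->
  (forall e, e \in T -> coloop I E e) -> s :|: T \in I.
Proof.
move=> sI sE; elim: {T}#|T| {-2}T (erefl #|T|) => [|n IH] T cT TE cl.
  by move/eqP: cT; rewrite cards_eq0 => /eqP ->; rewrite setU0.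
have [e eT] : exists e, e \in T by apply/set0Pn; rewrite -card_gt0 cT.
have T'E : T :\ e \subset E by apply: subset_trans TE; exact: subD1set.
have : s :|: (T :\ e) \in I.
  apply: IH => //; first by move: cT; rewrite (cardsD1 e) eT add1n => -[].
  by move=> f /setD1P[_ /cl].
move/(coloopP _ _ _ (cl e eT)).
by rewrite setUCA setD1K //; apply; rewrite subUset sE.
Qed.

(** * The coloopless part of a set *)

Definition cyclic_part E := [set e in E | ~~ coloop I E e].

Lemma cyclic_part_sub E : cyclic_part E \subset E.
Proof. by apply/subsetP => e; rewrite inE => /andP[]. Qed.

Lemma add_cyclic_compl E s : s \in I -> s \subset E ->
  s :|: (E :\: cyclic_part E) \in I.
Proof.
move=> sI sE; apply: (add_coloops sI sE); first exact: subsetDl.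
by move=> e /setDP[eE]; rewrite inE eE negbK.
Qed.

(** If [s] shows that [e] is not a coloop of [E], so does its trace on the cyclic part: were [e]
    addable to the trace, putting the coloops of [E] back would make [e |: s] independent. *)
Lemma cyclic_part_coloopless E : coloopless I (cyclic_part E).
Proof.
apply/forall_inP => e eC; move: (eC); rewrite inE => /andP[eE].
move=> /coloopPn[s [sI sE esI]]; apply/coloopPn.
exists (s :&: cyclic_part E); split; last 1 first.
- apply: contra esI => H.
  have H' : e |: (s :&: cyclic_part E) \subset E.
    by rewrite subUset sub1set eE (subset_trans (subsetIl _ _) sE).
  apply: matroid_sub hI _ _ (add_cyclic_compl H H') _.
  apply/subsetP => x; rewrite !in_setU !in_setI !in_setD.
  case/orP => [-> //|xs]; rewrite xs (subsetP sE x xs) andbT /=.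
  by case: (x \in cyclic_part E); rewrite ?orbT.
- exact: matroid_sub hI _ _ sI (subsetIl _ _).
- exact: subsetIr.
Qed.

(** A witness against being a coloop of [D] also works in [E]; hence the cyclic part is the largest
    coloopless subset. *)
Lemma cyclic_part_subset D E : coloopless I D -> D \subset E ->
  D \subset cyclic_part E.
Proof.
move=> /forall_inP clD DE; apply/subsetP => f fD.
rewrite inE (subsetP DE) //=; have /coloopPn[s [sI sD fs]] := clD f fD.
by apply/coloopPn; exists s; split=> //; exact: subset_trans sD DE.
Qed.

(** * Contraction by an independent set *)

Lemma disjointsU1 z s S :
  [disjoint z |: s & S] = (z \notin S) && [disjoint s & S].
Proof. by rewrite !disjoints_subset subUset sub1set inE. Qed.

Lemma contraction_matroid S : S \in I -> is_matroid (contraction I S).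
Proof.
move=> SI; split; first exact: matroid_ground hI.
- apply/set0Pn; exists set0; rewrite inE set0U SI andbT.
  by rewrite -setI_eq0 set0I.
- move=> s t; rewrite !inE => /andP[ds sI] ts.
  rewrite (disjointWl ts ds) /=.
  exact: matroid_sub hI _ _ sI (setSU S ts).
- move=> s a; rewrite !inE => /andP[ds sI] /andP[da aI] lt.
  have [|z] := matroid_exchange hI sI aI.
    move: ds da; rewrite !cardsU -!setI_eq0 => /eqP -> /eqP ->.
    by rewrite cards0 !subn0 ltn_add2r.
  rewrite !inE => /andP[/norP[zs zS]]; rewrite (negbTE zS) orbF => za zI.
  exists z; first by rewrite inE zs.
  by rewrite inE -setUA zI andbT disjointsU1 zS.
Qed.

Lemma contraction_basis D S B : S \in I -> [disjoint D & S] ->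
  basis (contraction I S) D B -> basis I (D :|: S) (B :|: S).
Proof.
move=> SI dDS bB; have [+ BD _] := bB; rewrite inE => /andP[dB BI].
apply: basis_maximal => //; first exact: setSU.
move=> z; rewrite !inE negb_or => /andP[/andP[zB zS]].
rewrite (negbTE zS) orbF => zD.
apply/negP => zI; case: bB => _ _ /(_ (z |: B)).
rewrite inE -setUA zI andbT disjointsU1 zS dB subUset sub1set zD BD.
by rewrite cardsU1 zB add1n ltnn => /(_ isT isT).
Qed.

(** Given [f] in [D], extend [S] by elements of a basis avoiding [f]. The result [t] is a basis that
    contains [S] and misses [f], so [t :\: S] shows that [f] is not a coloop of the contraction. *)
Lemma contraction_coloopless D S : S \in I -> [disjoint D & S] ->
  coloopless I (D :|: S) -> coloopless (contraction I S) D.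
Proof.
move=> SI dDS /forall_inP cl; apply/forall_inP => f fD.
have fS : f \notin S by rewrite (disjointFr dDS fD).
have fE : f \in D :|: S by rewrite inE fD.
have [A bA fA] := basis_avoiding (cl f fE); have [AI AE Am] := bA.
have [t [tI St tSA ct]] := augment SI AI (Am _ SI (subsetUr _ _)).
have tE : t \subset D :|: S.
  by apply: subset_trans tSA _; rewrite subUset subsetUr.
have ft : f \notin t.
  by apply/negP => /(subsetP tSA); rewrite inE (negbTE fS) (negbTE fA).
have tS : (t :\: S) :|: S = t.
  by rewrite setUC -{1}(setIidPr St) setID.
have bt : basis I (D :|: S) t.
  by split=> // u uI uE; rewrite ct Am.
apply/coloopPn; exists (t :\: S); split.
- rewrite inE tS tI andbT -setI_eq0; apply/eqP/setP => x.
  by rewrite !inE; case: (x \in S); rewrite ?andbF.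
- by rewrite subDset setUC.
- by rewrite inE -setUA tS negb_and (negbTE (basis_maxP bt fE ft)) orbT.
Qed.

Lemma rel_on_contraction_dep S D : S \notin I ->
  forall (R : comNzRingType) (q : R), rel_on q (contraction I S) D = 0.
Proof.
move=> SI R q; rewrite /rel_on big_pred0 // => s; rewrite inE.
case: (boolP (s :|: S \in I)) => H; last by rewrite andbF.
by case/negP: SI; apply: matroid_sub hI _ _ H (subsetUr _ _).
Qed.

(** * Series classes *)

(** For [e] outside a maximal [D], the cyclic part of [E :\ e] is coloopless, proper in [E] and
    contains [D], so it equals [D]. Thus deleting one element of [E :\: D] turns the others into
    coloops. *)
Lemma maximal_coloopless E : E != set0 ->
  exists D, [/\ D \proper E, coloopless I D &
    forall e, e \in E :\: D -> cyclic_part (E :\ e) = D].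
Proof.
move=> E0; pose P D := (D \proper E) && coloopless I D.
have P0 : P set0.
  by rewrite /P proper0 E0; apply/forall_inP => e; rewrite inE.
have [D /maxsetP[/andP[DE clD] Dm] _] := maxset_exists P0.
exists D; split=> // e /setDP[eE eD].
apply: Dm; last first.
  by apply: cyclic_part_subset => //; rewrite subsetD1 proper_sub.
rewrite /P cyclic_part_coloopless andbT.
by apply: sub_proper_trans (cyclic_part_sub _) _; exact: properD1.
Qed.

(** Some [e] of [E :\: D] is missing from [b], and all other elements of [E :\: D] are coloops of
    [E :\ e]. *)
Lemma series_free E D a b :
  (forall e, e \in E :\: D -> cyclic_part (E :\ e) = D) -> D \subset E ->
  a \in I -> a \subset D -> b \proper E :\: D -> a :|: b \in I.
Proof.
move=> cD DE aI aD /properP[bS [e eS eb]].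
have [eE eD] := setDP eS.
have aE : a \subset E :\ e by apply: subset_trans aD _; rewrite subsetD1 DE.
have := add_cyclic_compl aI aE; rewrite cD // => H.
apply: matroid_sub hI _ _ H _; apply: setUS; apply/subsetP => x xb.
move: (subsetP bS x xb); rewrite !inE => /andP[-> ->]; rewrite !andbT.
by apply: contraNneq eb => <-.
Qed.

(** This gives the rank of [E] as the rank of [D] plus [#|E :\: D| - 1]. *)
Lemma series_basis E D e B : coloopless I E ->
  (forall e, e \in E :\: D -> cyclic_part (E :\ e) = D) -> D \subset E ->
  e \in E :\: D -> basis I D B -> basis I E (B :|: ((E :\: D) :\ e)).
Proof.
move=> /forall_inP clE cD DE eS bB; have [BI BD _] := bB.
have [eE eD] := setDP eS.
have S'S : (E :\: D) :\ e \proper E :\: D by exact: properD1.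
have B'I := series_free cD DE BI BD S'S.
set B' := B :|: _ in B'I *.
have noD z : z \in D -> z \notin B' -> z |: B' \notin I.
  move=> zD; rewrite inE negb_or => /andP[zB _].
  apply: contra (basis_maxP bB zD zB) => H; apply: matroid_sub hI _ _ H _.
  exact: setUS (subsetUl _ _).
have B'E : B' \subset E.
  rewrite subUset (subset_trans BD DE); apply: subset_trans (proper_sub S'S) _.
  exact: subsetDl.
have [A [AI AE Am] eA] := basis_avoiding (clE e eE).
split=> // s sI sE; apply: leq_trans (Am s sI sE) _.
(* A larger basis [A] avoiding [e] would augment [B'] by some [z]. As [B'] has all of [E :\: D]
   except [e], [z] lies in [D], against the maximality of [B] there. *)
rewrite leqNgt; apply/negP => lt.
have [z /setDP[zA zB'] zI] := matroid_exchange hI B'I AI lt.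
have zD : z \in D.
  apply: contraNT zB' => zD; rewrite !inE zD (subsetP AE) // !andbT.
  by apply/orP; right; apply: contraNneq eA => <-.
by move: (noD z zD zB'); rewrite zI.
Qed.

End Matroid.

(** * Signs of the polynomial off the allowed set *)

Section Signs.
Variables (R : realDomainType) (X : finType) (q : R).
Implicit Types (I : {set {set X}}) (B D S E : {set X}).

Lemma rel_on_set0 I : is_matroid I -> rel_on q I set0 = 1.
Proof.
move=> hI; rewrite /rel_on (big_pred1 set0) => [|s].
  by rewrite /face_weight setDv cards0 !expr0 mulr1.
rewrite subset0 /=; case: eqP => [->|_]; last by rewrite andbF.
by rewrite matroid_set0.
Qed.

(** The induction on [#|E|] lets [I] vary, since one of the two minors is a contraction. *)
Lemma rel_on_sign_ltN1 I E B : q < -1 -> is_matroid I -> coloopless I E ->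
  basis I E B -> 0 < (-1) ^+ #|B| * rel_on q I E.
Proof.
move=> q1; move En: #|E| => n; elim/ltn_ind: n I E B En => n IH I E B En hI cl bB.
have [E0|E0] := eqVneq E set0.
  rewrite E0 in bB *; have [_ BE _] := bB.
  by move: BE; rewrite subset0 => /eqP ->; rewrite cards0 rel_on_set0 // mulr1.
have [D [DpE clD cD]] := maximal_coloopless hI E0.
have DE := proper_sub DpE.
set S := E :\: D in cD; have dDS : [disjoint D & S].
  by rewrite -setI_eq0 /S setIDA setDIl setDv set0I.
have ES : E = D :|: S by rewrite -{1}(setID E D) (setIidPr DE).
have cDE : (#|D| < n)%N by rewrite -En; exact: proper_card.
have [e eS] : exists e, e \in S by case/properP: DpE => _ [e *]; exists e; apply/setDP.
have [B' bB'] := basis_exists hI D.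
have cB : #|B| = (#|B'| + #|S|.-1)%N.
  rewrite (basis_card bB (series_basis hI cl cD DE eS bB')).
  have [_ B'D _] := bB'.
  have dB : [disjoint B' & S :\ e].
    by apply: disjointWl B'D (disjointWr (subD1set _ _) dDS).
  rewrite cardsU; move: dB; rewrite -setI_eq0 => /eqP ->.
  by rewrite cards0 subn0 [in RHS](cardsD1 e S) eS.
have posD := IH _ cDE I D B' erefl hI clD bB'.
rewrite [in rel_on _ _ _]ES rel_onU //; last 2 first.
- by move=> s t; exact: (matroid_sub hI).
- by move=> a b aI aD bS; apply: (series_free hI cD).
have S0 : (0 < #|S|)%N by rewrite card_gt0; apply/set0Pn; exists e.
have qS : (-1) ^+ #|S| * q ^+ #|S| > 1.
  by rewrite -exprMn mulN1r exprn_egt1 -?lt0n // ltrNr.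
have sS : (-1) ^+ #|S|.-1 = - (-1) ^+ #|S| :> R.
  by rewrite -[in RHS](prednK S0) exprS mulN1r opprK.
(* With k the size of [S], this product is [(-q)^k - (-1)^k], and [(-q)^k > 1]. *)
have coef : (-1) ^+ #|S|.-1 * (1 - q ^+ #|S|) > 0.
  rewrite sS mulrBr mulr1 mulNr opprK.
  rewrite addrC subr_gt0; apply: le_lt_trans qS.
  by rewrite -signr_odd; case: odd; rewrite ?expr1 // (le_trans (lerN10 R)).
have main : 0 < (-1) ^+ #|B| * ((1 - q ^+ #|S|) * rel_on q I D).
  have -> : (-1) ^+ #|B| * ((1 - q ^+ #|S|) * rel_on q I D) =
    ((-1) ^+ #|S|.-1 * (1 - q ^+ #|S|)) * ((-1) ^+ #|B'| * rel_on q I D).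
    by rewrite cB exprD; ring.
  exact: mulr_gt0.
(* The deletion term is strictly positive, so the contraction term need only be nonnegative; it
   vanishes when [S] is dependent. *)
rewrite mulrDr; apply: ltr_wpDr => //.
case: (boolP (S \in I)) => SI; last by rewrite (rel_on_contraction_dep hI) // !mulr0.
have hC := contraction_matroid hI SI.
have [B2 bB2] := basis_exists hC D.
have clC : coloopless (contraction I S) D.
  by apply: contraction_coloopless => //; rewrite -ES.
have posC := IH _ cDE _ D B2 erefl hC clC bB2.
have bB2S := contraction_basis hI SI dDS bB2; rewrite -ES in bB2S.
have cB2 : #|B| = (#|B2| + #|S|)%N.
  have [+ _ _] := bB2; rewrite inE -setI_eq0 => /andP[/eqP d _].
  by rewrite (basis_card bB bB2S) cardsU d cards0 subn0.
have -> : (-1) ^+ #|B| * (q ^+ #|S| * rel_on q (contraction I S) D) =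
   ((-1) ^+ #|S| * q ^+ #|S|) * ((-1) ^+ #|B2| * rel_on q (contraction I S) D).
  by rewrite cB2 exprD; ring.
by apply: mulr_ge0; apply: ltW => //; apply: lt_trans qS.
Qed.

Lemma rel_on_neq0_ltN1 I : q < -1 -> is_matroid I -> rel_on q I setT != 0.
Proof.
move=> q1 hI; set C := cyclic_part I setT.
have [B bB] := basis_exists hI C.
have : 0 < (-1) ^+ #|B| * rel_on q I C.
  by apply: rel_on_sign_ltN1 => //; exact: cyclic_part_coloopless.
have TC : [set: X] = C :|: ~: C by rewrite setUCr.
rewrite TC rel_onU_free.
- by move=> H; apply: contraTneq H => ->; rewrite mulr0 ltxx.
- by move=> s t; exact: (matroid_sub hI).
- by rewrite -setI_eq0 setICr.
- by move=> a aI _; have := add_cyclic_compl aI (subsetT a); rewrite setTD.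
Qed.

(* The sign is [(-1)^(|E| - |B|)]; the exponent is written as a sum to avoid
   truncated subtraction. *)
Lemma rel_on_sign_gt1 I E B : 1 < q -> is_matroid I -> basis I E B ->
  0 < (-1) ^+ (#|E| + #|B|) * rel_on q I E.
Proof.
move=> q1; move En: #|E| => n; elim: n I E B En => [|n IH] I E B En hI bB.
  move/eqP: En; rewrite cards_eq0 => /eqP E0.
  rewrite E0 in bB *; have [_ BE _] := bB.
  by move: BE; rewrite subset0 => /eqP ->; rewrite cards0 rel_on_set0 // mulr1.
have [e eE] : exists e, e \in E by apply/set0Pn; rewrite -card_gt0 En.
have dDS : [disjoint E :\ e & [set e]] by rewrite disjoint_sym disjoints1 !inE eqxx.
have ES : E = (E :\ e) :|: [set e] by rewrite setUC setD1K.
have cD : #|E :\ e| = n by move: En; rewrite (cardsD1 e) eE add1n => -[].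
have Isub (s t : {set X}) : s \in I -> t \subset s -> t \in I.
  exact: (matroid_sub hI).
(* Removing a coloop lowers both size and rank by one, so the sign is unchanged. *)
case: (boolP (coloop I E e)) => ce.
  have free a : a \in I -> a \subset E :\ e -> a :|: [set e] \in I.
    move=> aI aD; rewrite setUC; apply: (coloopP _ _ _ ce) => //.
    by apply: subset_trans aD (subD1set _ _).
  rewrite ES rel_onU_free //; have [B' bB'] := basis_exists hI (E :\ e).
  have [B'I B'D B'm] := bB'.
  have eB' : e \notin B' by apply/negP => /(subsetP B'D); rewrite !inE eqxx.
  have bB'' : basis I E (e |: B').
    apply: (basis_maximal hI); first by rewrite setUC free.
      by rewrite subUset sub1set eE (subset_trans B'D (subD1set _ _)).
    move=> z; rewrite !inE => /andP[/norP[ze zB'] zE].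
    have zD : z \in E :\ e by rewrite !inE ze.
    apply: contra (basis_maxP bB' zD zB') => H.
    by apply: Isub H _; rewrite setUS // subsetUr.
  have := IH _ _ _ cD hI bB'.
  rewrite (basis_card bB bB'') cardsU1 eB' add1n addSnnS.
  by rewrite !addnS !exprS !mulN1r opprK.
(* Deleting a non-coloop keeps the rank; the sign change from the size is absorbed by [1 - q < 0].
   Contracting it, if it is not a loop, lowers size and rank together. *)
have [A bA eA] := basis_avoiding hI ce; have [AI AE Am] := bA.
have bA' : basis I (E :\ e) A.
  split=> //; first by rewrite subsetD1 AE.
  by move=> s sI sD; apply: Am => //; apply: subset_trans sD (subD1set _ _).
have posD := IH _ _ _ cD hI bA'.
rewrite (basis_card bB bA) ES rel_onU //; last first.
  by move=> a b aI _; rewrite properE subset1 => /andP[/orP[]/eqP-> ];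
    rewrite ?subxx // setU0.
rewrite cards1 expr1 mulrDr; apply: ltr_wpDr; last first.
  have -> : (-1) ^+ (n.+1 + #|A|) * ((1 - q) * rel_on q I (E :\ e)) =
    (q - 1) * ((-1) ^+ (n + #|A|) * rel_on q I (E :\ e)).
    by rewrite addSn exprS; ring.
  by apply: mulr_gt0 => //; rewrite subr_gt0.
case: (boolP ([set e] \in I)) => SI; last by rewrite (rel_on_contraction_dep hI) // !mulr0.
have hC := contraction_matroid hI SI.
have [B2 bB2] := basis_exists hC (E :\ e).
have posC := IH _ _ _ cD hC bB2.
have bB2S := contraction_basis hI SI dDS bB2; rewrite -ES in bB2S.
have cA : #|A| = #|B2|.+1.
  have [+ _ _] := bB2; rewrite inE -setI_eq0 => /andP[/eqP d _].
  by rewrite (basis_card bA bB2S) cardsU d cards0 subn0 cards1 addn1.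
have -> : (-1) ^+ (n.+1 + #|A|) * (q * rel_on q (contraction I [set e]) (E :\ e)) =
   q * ((-1) ^+ (n + #|B2|) * rel_on q (contraction I [set e]) (E :\ e)).
  by rewrite cA addnS addSn !exprS; ring.
by apply: mulr_ge0; apply: ltW => //; apply: lt_trans q1.
Qed.

(** All terms are nonnegative, and the empty face contributes a positive power of [1 - q]. *)
Lemma rel_on_gt0 I E : 0 <= q < 1 -> is_matroid I -> 0 < rel_on q I E.
Proof.
move=> /andP[q0 q1] hI; rewrite /rel_on (bigD1 set0) /=; last first.
  by rewrite matroid_set0 // sub0set.
have p : 0 < 1 - q by rewrite subr_gt0.
apply: ltr_wpDr.
  by apply: sumr_ge0 => s _; rewrite mulr_ge0 // exprn_ge0 // ltW.
by rewrite /face_weight cards0 expr0 mul1r exprn_gt0.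
Qed.

End Signs.

(** * Evaluation of the polynomial and location of its roots *)

Lemma horner_Rel (R : realType) (X : finType) (M : {set {set X}}) (q : R) :
  (Rel R M).[q] = rel_on q M setT.
Proof.
rewrite /Rel /rel_on horner_sum; apply: eq_big => [s|s _].
  by rewrite subsetT andbT.
by rewrite /face_weight setTD hornerM !horner_exp hornerD hornerN hornerC hornerX.
Qed.

Theorem theorem3 (R : realType) (X : finType) (M : {set {set X}})
  (hM : is_matroid M) (q : R) (hq : root (Rel R M) q) :
  (-1 <= q < 0 \/ q = 1) /\ `|q| <= 1.
Proof.
have {hq} q0 : rel_on q M setT = 0 by rewrite -horner_Rel; exact/rootP.
suff H : -1 <= q < 0 \/ q = 1.
  by split=> //; rewrite ler_norml; case: H => [/andP[]|]; lra.
have [->|q1] := eqVneq q 1; [by right | left].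
apply/andP; split; rewrite ?leNgt; first apply/negP => qN1.
  by have := rel_on_neq0_ltN1 qN1 hM; rewrite q0 eqxx.
rewrite ltNge; apply/negP => qge0; case: (ltgtP q 1) => qc.
- by have := @rel_on_gt0 _ _ q M setT; rewrite qge0 qc q0 ltxx => /(_ isT hM).
- have [B bB] := basis_exists hM setT.
  by have := rel_on_sign_gt1 qc hM bB; rewrite q0 mulr0 ltxx.
- by rewrite qc eqxx in q1.
Qed.
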